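(* Let $\mathcal{A}$ be a finite collection of arithmetic progressions $a_i + d_i\mathbb{Z}$ with moduli $d_i > 1$, such that the moduli $d_i$ are pairwise distinct and each $d_i$ is square-free, and such that $\bigcup_i (a_i + d_i\mathbb{Z}) = \mathbb{Z}$. Then at least one of the moduli $d_i$ is even. *)

(* Defs.v *)
From mathcomp Require Import all_boot all_order all_algebra.
Set Implicit Arguments. Unset Strict Implicit. Unset Printing Implicit Defensive.

Definition squarefree (n : nat) : Prop :=
  forall p : nat, prime p -> ~~ (p * p %| n)%N.

(* Main.v *)
From Stdlib Require Import NArith.
Require Import Defs.
From mathcomp Require Import all_boot all_order all_algebra.
From mathcomp Require Import zify ring lra.

Set Implicit Arguments. Unset Strict Implicit. Unset Printing Implicit Defensive.
Import Order.TTheory GRing.Theory Num.Theory.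
Local Open Scope ring_scope.

(** Suppose that all moduli are odd, and choose the residue of [x] modulo
    3, 5, 7, 11, ... one prime at a time.  At [p], besides the residue of the
    progression of modulus [p], the [n] progressions still compatible with [x]
    whose modulus has largest prime factor [p] must be avoided.  The choice is
    guided by a pessimistic estimator of future trouble: pretend that, for every
    later prime [q], all progressions agree on one residue modulo [q], which [x]
    hits independently with probability [1 / (q - s)], where [s] is about [q / 5];
    sum over the later primes the expectations of the losses
    [max (n + 1 - s) 0 / (q - s)].  The loss is convex, so the estimator is
    supermodular in the set of surviving progressions, and averaging over the
    admissible residues shows that one of them keeps the estimator below 1.

    As the moduli are distinct and square-free, at most [2 ^ k - 1] progressions
    end at [p] when [k] of the earlier coincidences happen.  This bounds the
    initial estimator by a series over the primes, whose sum is about 0.94: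
    computed directly for [p < 300], through the second moment [4 ^ k] for
    [p < 21000], and beyond that by using only that primes are coprime to 210. *)

(** This is [p / 5] rounded up, the [s] of the overview: up to [thr p] residues modulo [p] can be
    forbidden without any loss. *)
Definition thr (p : nat) : nat := ((p + 4) %/ 5)%N.
Definition wid (p : nat) : nat := (p - thr p)%N.

Lemma modz_dvd_trans (m n : nat) (x y : int) :
  (m %| n)%N -> (x = y %[mod n])%Z -> (x = y %[mod m])%Z.
Proof.
move=> mn /eqP; rewrite eqz_mod_dvd => h; apply/eqP; rewrite eqz_mod_dvd.
exact: dvdz_trans h.
Qed.

Lemma absz_modz_lt (p : nat) (x : int) : (0 < p)%N -> (`|(x %% p)%Z| < p)%N.
Proof. by move=> p_gt0; rewrite -ltz_nat gez0_abs ?modz_ge0 ?ltz_pmod //; lia. Qed.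

Section Covering.
Variable R : realFieldType.

(* With [n] progressions to avoid at [p], the loss is [loss p n.+1]. *)
Definition loss (p z : nat) : R := (z - thr p)%N%:R / (wid p)%:R.

Lemma loss_ge0 p z : 0 <= loss p z.
Proof. by rewrite divr_ge0. Qed.

Lemma loss_mono p y z : (y <= z)%N -> loss p y <= loss p z.
Proof. by move=> yz; rewrite ler_wpM2r ?invr_ge0 // ler_nat leq_sub2r. Qed.

Lemma loss_convex p x y u v : (x <= u <= v)%N -> (x <= y <= v)%N ->
  (x + v = u + y)%N -> loss p u + loss p y <= loss p x + loss p v.
Proof.
move=> xuv xyv e; rewrite /loss -!mulrDl ler_wpM2r ?invr_ge0 //.
by rewrite -!natrD ler_nat; lia.
Qed.

Definition wgt (p : nat) : R := (wid p)%:R^-1.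

Lemma wgt_ge0 p : 0 <= wgt p.
Proof. by rewrite invr_ge0. Qed.

Lemma wgt_le1 p : wgt p <= 1.
Proof.
rewrite /wgt; case: (wid p) => [|n]; first by rewrite invr0.
by rewrite invf_le1 ?ltr0n // ler1n.
Qed.

(** * The pessimistic estimator *)

Section Risk.
Variables (I : finType) (d : I -> nat).

Definition mult (p : nat) : {set I} := [set i | (p %| d i)%N].

Definition last_at (p : nat) (qs : seq nat) : {set I} :=
  [set i | [&& (p %| d i)%N, d i != p & all (fun q => ~~ (q %| d i)%N) qs]].

(* The estimator: [A] is the set of surviving progressions, [ps] the list of
   primes to come; the two recursive calls are the outcomes "[x] misses" and
   "[x] hits" the common residue modulo [p]. *)
Fixpoint risk (ps : seq nat) (A : {set I}) : R :=
  if ps is p :: qs then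
    loss p #|A :&: last_at p qs|.+1
    + (1 - wgt p) * risk qs (A :\: mult p) + wgt p * risk qs A
  else 0.

Lemma risk_ge0 ps A : 0 <= risk ps A.
Proof.
elim: ps A => //= p qs IH A.
by rewrite !addr_ge0 ?loss_ge0 // mulr_ge0 // ?subr_ge0 ?wgt_le1 ?wgt_ge0.
Qed.

Lemma risk_mono ps (A B : {set I}) : A \subset B -> risk ps A <= risk ps B.
Proof.
elim: ps A B => //= p qs IH A B sAB.
rewrite !lerD //.
- by rewrite loss_mono // ltnS subset_leq_card // setSI.
- by rewrite ler_wpM2l ?subr_ge0 ?wgt_le1 // IH // setSD.
- by rewrite ler_wpM2l ?wgt_ge0 // IH.
Qed.

(** Intersecting with [L] and removing [mult p] commute with unions and intersections, so the
    convexity of the loss passes through the induction. *)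
Lemma risk_supermod ps (A B : {set I}) :
  risk ps A + risk ps B <= risk ps (A :&: B) + risk ps (A :|: B).
Proof.
elim: ps A B => [|p qs IH] A B /=; first by rewrite addr0.
set L := last_at p qs.
have hloss : loss p #|A :&: L|.+1 + loss p #|B :&: L|.+1
    <= loss p #|A :&: B :&: L|.+1 + loss p #|(A :|: B) :&: L|.+1.
  apply: loss_convex; rewrite ?ltnS.
  - by rewrite !subset_leq_card ?setSI ?subsetIl ?subsetUl.
  - by rewrite !subset_leq_card ?setSI ?subsetIr ?subsetUr.
  - rewrite setIUl setIIl !addSn !addnS; congr _.+2.
    by rewrite -[RHS]cardsUI addnC.
have h1 := IH (A :\: mult p) (B :\: mult p).
rewrite -setDUl -setDIl in h1.
have h2 := IH A B.
have w0 := wgt_ge0 p; have w1 := wgt_le1 p.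
have {}h1 := ler_wpM2l (_ : 0 <= 1 - wgt p) h1.
rewrite subr_ge0 !mulrDr in h1; have {}h1 := h1 w1.
have {}h2 := ler_wpM2l w0 h2; rewrite !mulrDr in h2.
lra.
Qed.

(* Supermodularity makes the increments superadditive in the value of [f]. *)
Lemma risk_fibres (T : finType) (f : I -> T) ps (A M : {set I}) (S : {set T}) :
  \sum_(c in S) (risk ps [set i in A | (i \in M) ==> (f i == c)] - risk ps (A :\: M))
    <= risk ps A - risk ps (A :\: M).
Proof.
pose F (s : seq T) := [set i in A | (i \in M) ==> (f i \in s)].
suff H s : uniq s ->
    \sum_(c <- s) (risk ps [set i in A | (i \in M) ==> (f i == c)] - risk ps (A :\: M))
      <= risk ps (F s) - risk ps (A :\: M).
  rewrite -big_enum /=; apply: le_trans (H _ (enum_uniq _)) _.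
  by rewrite lerD2r risk_mono //; apply/subsetP=> i; rewrite inE => /andP[].
elim: s => [_|c s IH /= /andP[cs us]]; first by rewrite big_nil subr_ge0 risk_mono //;
  apply/subsetP=> i; rewrite !inE => /andP[/negbTE-> ->].
rewrite big_cons.
have := risk_supermod ps [set i in A | (i \in M) ==> (f i == c)] (F s).
have -> : [set i in A | (i \in M) ==> (f i == c)] :|: F s = F (c :: s).
  apply/setP=> i; rewrite !inE; case: (i \in A) => //=.
  by case: (i \in M).
have -> : [set i in A | (i \in M) ==> (f i == c)] :&: F s = A :\: M.
  apply/setP=> i; rewrite !inE; case: (i \in A); rewrite ?andbF //=.
  case: (i \in M) => //=; case: eqP => //= ->; exact: negbTE.
have := IH us; set X := \sum_(_ <- _) _; lra.
Qed.

(** Let [g0], [g] be the risks of [A :\: mult p] and [A], and [k] the excess of [n.+1] over [thr p].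
    Clearing denominators, the hypothesis reads [g - g0 < w * (1 - g0) - k], which forces [g0 < 1]
    as [g0 <= g]. At least [w - k] residues are good; were all their risks at least 1, [risk_fibres]
    would give [(w - k) * (1 - g0) <= g - g0], a contradiction. *)
Lemma exists_safe_residue (p : nat) (f : I -> 'I_p) qs (A : {set I}) :
    injective d -> (2 < p)%N -> risk (p :: qs) A < 1 ->
  exists c : 'I_p,
    [/\ forall i, i \in A -> d i = p -> f i != c,
        forall i, i \in A -> i \in last_at p qs -> f i != c
      & risk qs [set i in A | (i \in mult p) ==> (f i == c)] < 1].
Proof.
move=> injd p_gt2 /= rlt1.
set n := #|A :&: last_at p qs| in rlt1.
pose bad := f @: (A :&: last_at p qs) :|: f @: [set i in A | d i == p].
have bad_le : (#|bad| <= n + 1)%N.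
  rewrite (leq_trans (leq_card_setU _ _)) // leq_add ?leq_imset_card //.
  rewrite (leq_trans (leq_imset_card _ _)) //; apply/card_le1_eqP => i j.
  by rewrite !inE => /andP[_ /eqP di] /andP[_ /eqP dj]; apply: injd; rewrite di dj.
have goodE : (p <= #|~: bad| + n.+1)%N.
  by have := cardsC bad; rewrite card_ord; lia.
have [c cgood rc] : exists2 c, c \in ~: bad &
    risk qs [set i in A | (i \in mult p) ==> (f i == c)] < 1.
  apply/exists_inP; apply: contraT; rewrite negb_exists_in => /forall_inP hge.
  have := @risk_fibres _ f qs A (mult p) (~: bad).
  set g0 := risk qs (A :\: mult p) in rlt1 *; set g := risk qs A in rlt1 *.
  have g0_ge0 : 0 <= g0 := risk_ge0 _ _.
  have gg0 : g0 <= g by rewrite risk_mono // subsetDl.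
  move=> hsum.
  have {hsum} hm : #|~: bad|%:R * (1 - g0) <= g - g0.
    apply: le_trans hsum; rewrite mulr_natl -sumr_const ler_sum // => c cg.
    by rewrite lerD2r leNgt hge.
  have w_gt0 : 0 < (wid p)%:R :> R by rewrite ltr0n /wid /thr; lia.
  move: rlt1; rewrite /loss /wgt; set w := (wid p)%:R; set k := (_ - _)%N => rlt1.
  have {}rlt1 : k%:R + w * g0 + (g - g0) < w.
    rewrite -subr_gt0.
    have -> : w - (k%:R + w * g0 + (g - g0)) =
      w * (1 - (k%:R / w + (1 - w^-1) * g0 + w^-1 * g)) by field; rewrite gt_eqF.
    by rewrite mulr_gt0 // subr_gt0.
  have hmw : w <= #|~: bad|%:R + k%:R.
    by rewrite -natrD ler_nat /wid /k; lia.
  have k_ge0 : 0 <= k%:R :> R := ler0n _ _.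
  have [g0lt|g0ge] := ltP g0 1; last by nra.
  have : (w - k%:R) * (1 - g0) <= #|~: bad|%:R * (1 - g0).
    by rewrite ler_wpM2r //; lra.
  by nra.
exists c; split=> // i iA.
  move=> dip; apply: contraNneq (_ : c \notin bad) => [<-|]; last by rewrite -in_setC.
  by rewrite inE orbC imset_f // inE iA dip eqxx.
move=> il; apply: contraNneq (_ : c \notin bad) => [<-|]; last by rewrite -in_setC.
by rewrite inE imset_f // inE iA il.
Qed.

End Risk.
(* [y] is the residue of [x] modulo [Q], the product of the primes treated so far. *)
Lemma exists_uncovered (I : finType) (a : I -> int) (d : I -> nat) ps Q (y : int) (A : {set I}) :
    injective d -> uniq ps -> (0 < Q)%N ->
    (forall p, p \in ps -> [/\ prime p, (2 < p)%N & coprime p Q]) ->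
    (forall i, (d i %| Q * \prod_(p <- ps) p)%N) ->
    (forall i, (d i %| Q)%N -> i \notin A) ->
    (forall i x, i \notin A -> (x = y %[mod Q])%Z -> ~ (x = a i %[mod d i])%Z) ->
    risk d ps A < 1 ->
  exists x, forall i, ~ (x = a i %[mod d i])%Z.
Proof.
move=> injd; elim: ps Q y A => [|p qs IH] Q y A.
  move=> _ _ _ dQ dA yA _; exists y => i; apply: yA => //; apply: dA.
  by have := dQ i; rewrite big_nil muln1.
rewrite cons_uniq => /andP[pqs uqs] Q_gt0 hps dQ dA yA rlt1.
have [p_pr p_gt2 p_co] := hps p (mem_head _ _).
have p_gt0 : (0 < p)%N by lia.
pose f i := Ordinal (absz_modz_lt (a i) p_gt0).
have [c [hc1 hc2 rc]] := exists_safe_residue f injd p_gt2 rlt1.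
have coz : coprimez Q p by rewrite coprimezE /= coprime_sym.
pose y' := zchinese Q p y c.
have y'Q : (y' = y %[mod Q])%Z by apply: zchinese_modl.
have y'p : (y' = c %[mod p])%Z by apply: zchinese_modr.
have fP i x : (p %| d i)%N -> (x = y' %[mod (Q * p)%N])%Z -> (x = a i %[mod d i])%Z -> f i = c.
  move=> pd hx /(modz_dvd_trans pd) e; apply/val_inj => /=; rewrite -e.
  rewrite (modz_dvd_trans (dvdn_mull _ (dvdnn p)) hx) y'p modz_small //=.
  by have := ltn_ord c; lia.
apply: (IH (Q * p)%N y' [set i in A | (i \in mult d p) ==> (f i == c)]) => //.
- by rewrite muln_gt0 Q_gt0.
- move=> q qqs; have [|q_pr q_gt2 q_co] := hps q; first by rewrite inE qqs orbT.
  split=> //; rewrite coprimeMr q_co /= prime_coprime // dvdn_prime2 //.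
  by apply: contraNneq pqs => <-.
- by move=> i; have := dQ i; rewrite big_cons mulnA.
(* A modulus dividing [Q * p] but not [Q] is a multiple of [p] without later prime factors: it is
   [p] itself or lies in [last_at], and [c] avoids both kinds. *)
- move=> i diQp; apply/negP; rewrite !inE => /andP[iA hi].
  have ndQ : ~~ (d i %| Q)%N by apply: contraL iA => /dA.
  have pd : (p %| d i)%N.
    apply: contraNT ndQ; rewrite -prime_coprime // coprime_sym => co.
    by rewrite -(Gauss_dvdl _ co).
  rewrite pd /= in hi.
  have [dip|dip] := eqVneq (d i) p; first by rewrite (negbTE (hc1 i iA dip)) in hi.
  have il : i \in last_at d p qs.
    rewrite inE pd dip; apply/allP => q qqs; apply/negP => qd.
    have [|q_pr q_gt2 q_co] := hps q; first by rewrite inE qqs orbT.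
    have := dvdn_trans qd diQp; rewrite Gauss_dvdr // dvdn_prime2 // => /eqP qp.
    by rewrite -qp qqs in pqs.
  by rewrite (negbTE (hc2 i iA il)) in hi.
- move=> i x iA hx; case: (boolP (i \in A)) iA => iA; rewrite inE ?iA ?(negbTE iA) /=; last first.
    move=> _; apply: yA => //.
    by rewrite (modz_dvd_trans (dvdn_mulr _ (dvdnn Q)) hx).
  rewrite negb_imply inE => /andP[pd fc] e.
  by rewrite (fP i x pd hx e) eqxx in fc.
Qed.

(** * Bounding the initial risk *)

Lemma divisors_prod_primes (S : seq nat) : all prime S ->
  exists2 s : seq nat, size s = (2 ^ size S)%N &
    forall e, (e %| \prod_(q <- S) q)%N -> e \in s.
Proof.
elim: S => [_|q S IH /= /andP[q_pr /IH[s sz hs]]].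
  by exists [:: 1%N] => // e; rewrite big_nil dvdn1 inE.
exists (s ++ map (muln q) s) => [|e]; first by rewrite size_cat size_map sz expnS mul2n addnn.
rewrite big_cons mem_cat; have [/dvdnP[e' ->]|qe] := boolP (q %| e)%N.
  rewrite mulnC dvdn_pmul2l ?prime_gt0 // => /hs e's.
  by rewrite map_f ?orbT.
have co : coprime e q by rewrite coprime_sym prime_coprime.
by rewrite Gauss_dvdr // => /hs->.
Qed.

(* Bounds [risk ps A] when [k] coincidences have occurred before [ps]. *)
Fixpoint load (ps : seq nat) (k : nat) : R :=
  if ps is p :: qs then
    loss p (2 ^ k) + (1 - wgt p) * load qs k + wgt p * load qs k.+1
  else 0.

(** These moduli are [p * e] with [e] dividing the product of [S]. The value [e = 1] is excluded by
    [d i != p], whence the strict inequality: [p] is put in front of the list before counting. *)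
Lemma card_last_at (I : finType) (d : I -> nat) p qs S (A : {set I}) :
    injective d -> all prime (S ++ p :: qs) ->
    (forall i, i \in A -> (d i %| \prod_(q <- S ++ p :: qs) q)%N) ->
  (#|A :&: last_at d p qs| < 2 ^ size S)%N.
Proof.
move=> injd; rewrite all_cat /= => /and3P[Spr p_pr qpr] dA.
have [s sz hs] := divisors_prod_primes Spr.
rewrite -sz -(size_map (muln p)) cardE -(size_map d).
apply: (@uniq_leq_size _ (p :: map d (enum (A :&: last_at d p qs)))).
  rewrite /= map_inj_uniq // enum_uniq andbT.
  by apply/mapP => -[i]; rewrite mem_enum !inE => /and4P[_ _ /eqP dip _] pdi; apply: dip.
move=> x; rewrite inE => /predU1P[->|].
  by rewrite -[X in X \in _]muln1 map_f // hs.
case/mapP => i; rewrite mem_enum !inE => /and4P[iA /dvdnP[e de] dip hq] ->.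
rewrite de mulnC map_f // hs //.
have co : coprime (d i) (\prod_(q <- qs) q).
  rewrite big_seq; apply: (big_ind (coprime (d i))) => [|x1 x2 h1 h2|q qqs].
  - exact: coprimen1.
  - by rewrite coprimeMr h1.
  - by rewrite coprime_sym prime_coprime ?(allP qpr) ?(allP hq).
have := dA i iA; rewrite big_cat big_cons /= mulnA Gauss_dvdl // de.
by rewrite dvdn_pmul2r ?prime_gt0.
Qed.

(** [S] collects the primes of past coincidences. On a miss the multiples of [p] disappear, so [p]
    leaves the product; on a hit [p] joins [S]. *)
Lemma risk_le_load (I : finType) (d : I -> nat) ps S (A : {set I}) :
    injective d -> all prime (S ++ ps) ->
    (forall i, i \in A -> (d i %| \prod_(q <- S ++ ps) q)%N) ->
  risk d ps A <= load ps (size S).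
Proof.
move=> injd; elim: ps S A => //= p qs IH S A pr dA.
have [Spr p_pr qpr] : [/\ all prime S, prime p & all prime qs].
  by move: pr; rewrite all_cat /= => /and3P.
rewrite !lerD //.
- by rewrite loss_mono // card_last_at.
- rewrite ler_wpM2l ?subr_ge0 ?wgt_le1 // IH // => [|i]; first by rewrite all_cat Spr.
  rewrite inE => /andP[]; rewrite inE => pdi /dA; rewrite !big_cat big_cons /= mulnCA.
  by rewrite Gauss_dvdr // coprime_sym prime_coprime.
- rewrite ler_wpM2l ?wgt_ge0 // (IH (p :: S)) => [//||i /dA]; first by rewrite /= p_pr all_cat Spr.
  by rewrite !big_cat !big_cons /= mulnCA mulnA.
Qed.

(* [slope ps * 4 ^ k] bounds [load ps k], through the parabola
   [4 s (z - s) <= z ^ 2] at [z = 2 ^ k]. *)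
Fixpoint slope (ps : seq nat) : R :=
  if ps is p :: qs then
    (4 * thr p * wid p)%:R^-1 + (1 + 3 * wgt p) * slope qs
  else 0.

Lemma slope_ge0 ps : 0 <= slope ps.
Proof.
elim: ps => //= p qs IH.
by rewrite addr_ge0 ?invr_ge0 // mulr_ge0 // addr_ge0 // mulr_ge0 ?wgt_ge0.
Qed.

Lemma load_le_slope ps k : load ps k <= slope ps * 4 ^+ k.
Proof.
elim: ps k => [|p qs IH] k /=; first by rewrite mul0r.
(* With [w = wgt p], averaging over miss and hit multiplies [4 ^ k] by
   [(1 - w) + 4 * w = 1 + 3 * w]. *)
have h1 := IH k; have h2 := IH k.+1; rewrite exprS in h2.
have w0 := wgt_ge0 p; have w1 := wgt_le1 p.
have h0 : loss p (2 ^ k) <= (4 * thr p * wid p)%:R^-1 * 4 ^+ k.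
  rewrite /loss; have [->|w_gt0] := posnP (wid p); first by rewrite invr0 mulr0 muln0 invr0 mul0r.
  have s_gt0 : (0 < thr p)%N by move: w_gt0; rewrite /wid /thr; lia.
  rewrite natrM invfM mulrAC ler_wpM2r ?invr_ge0 //.
  rewrite ler_pdivlMl ?ltr0n ?muln_gt0 ?s_gt0 //.
  rewrite -natrM -natrX ler_nat (_ : 4 ^ k = 2 ^ k * 2 ^ k)%N; last by rewrite -expnMn.
  have [zs|sz] := leqP (2 ^ k) (thr p).
    by rewrite (eqP (zs : _ - _ == 0)%N) muln0.
  by rewrite -mulnA -{2 3}(subnKC (ltnW sz)) mulnn nat_AGM2.
have {}h1 := ler_wpM2l (_ : 0 <= 1 - wgt p) h1.
rewrite subr_ge0 in h1; have {}h1 := h1 w1.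
have {}h2 := ler_wpM2l w0 h2.
apply: le_trans (lerD (lerD h0 h1) h2) _; rewrite le_eqVlt; apply/orP; left; apply/eqP.
ring.
Qed.

(** * The tail of the series, in blocks of length 210 *)

Lemma bernoulli_inv (v : R) n : 0 <= v -> (1 + v) ^+ n * (1 - n%:R * v) <= 1.
Proof.
move=> v0; elim: n => [|n IH]; first by rewrite expr0 mul0r subr0 mulr1.
rewrite (le_trans _ IH) // exprSr -mulrA ler_wpM2l ?exprn_ge0 ?addr_ge0 //.
have n0 : 0 <= n%:R :> R := ler0n _ _.
by rewrite -natr1; nra.
Qed.

(* A block of primes [p >= 210 m], where [thr p >= 42 m] and [wid p >= 168 m];
   [- e] is the fixed point of the worst affine step, so adding [e] makes the
   steps linear. *)
Lemma slope_cat (m : nat) (ps qs : seq nat) (e := (504 * m)%:R^-1) :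
    (0 < m)%N -> all (leq (210 * m)) ps ->
  slope (ps ++ qs) + e <= (1 + 3 / (168 * m)%:R) ^+ size ps * (slope qs + e).
Proof.
move=> m_gt0; elim: ps => [|p ps IH] /=; first by rewrite expr0 mul1r.
move=> /andP[mp /IH{}IH]; rewrite exprS -mulrA.
have e0 : 0 < e by rewrite invr_gt0 ltr0n; lia.
have r0 := slope_ge0 (ps ++ qs).
have s_ge : (42 * m <= thr p)%N by rewrite /thr; lia.
have w_ge : (168 * m <= wid p)%N by rewrite /wid /thr; lia.
have hw : wgt p <= (168 * m)%:R^-1.
  by rewrite lef_pV2 ?posrE ?ltr0n ?ler_nat //; lia.
(* Here [4 * thr p >= 168 * m] and [3 * e = 1 / (168 * m)]; so the step sends [r + e] to at most
   [(1 + 3 * wgt p) * (r + e)]. *)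
have hs : (4 * thr p * wid p)%:R^-1 <= 3 * e * wgt p.
  rewrite natrM invfM ler_wpM2r ?wgt_ge0 //.
  have -> : 3 * e = (4 * (42 * m))%:R^-1.
    by rewrite /e (_ : 504 * m = 3 * (4 * (42 * m)))%N; [rewrite natrM invfM mulVKf ?pnatr_eq0|lia].
  by rewrite lef_pV2 ?posrE ?ltr0n ?ler_nat //; lia.
apply: le_trans (_ : _ <= (1 + 3 / (168 * m)%:R) * (slope (ps ++ qs) + e)) _; last first.
  by rewrite ler_wpM2l // addr_ge0 // mulr_ge0 // invr_ge0.
have w0 := wgt_ge0 p.
set u := _^-1 in hw *; nra.
Qed.

(** 48 is the totient of 210, and primes above 210 are coprime to it. *)
Lemma size_primes_block (m : nat) : (1 < m)%N ->
  (size [seq p <- iota (210 * m) 210 | prime p] <= 48)%N.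
Proof.
move=> m_gt1.
have hcount : count (coprime 210) (iota (210 * m) 210) = 48%N.
  rewrite -{1}[(210 * m)%N]addn0 iotaDl count_map.
  rewrite (@eq_count _ _ (coprime 210)); first by vm_compute.
  by move=> i /=; rewrite /coprime mulnC gcdnMDl.
apply: leq_trans (_ : _ <= count (coprime 210) (iota (210 * m) 210))%N _; last by rewrite hcount.
rewrite -size_filter uniq_leq_size ?filter_uniq ?iota_uniq // => p.
rewrite !mem_filter mem_iota => /andP[p_pr /andP[mp ->]].
by rewrite mp coprime_sym prime_coprime // gtnNdvd //; lia.
Qed.

(* [slope <= 1 / (75 m)] propagates from block [m + 1] to block [m]; the growth
   factor [g] is [(1 + 3 / (168 m)) ^ 48]. *)
Lemma block_recursion (m g x y : R) : 100 <= m -> 0 <= y ->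
    g * (1 - 48 * (m^-1 / 56)) <= 1 -> x + m^-1 / 504 <= g * (y + m^-1 / 504) ->
    y <= (m + 1)^-1 / 75 ->
  x <= m^-1 / 75.
Proof.
move=> m_ge y_ge0; set u := m^-1; set v := (m + 1)^-1 => hg hx hy.
have u_gt0 : 0 < u by rewrite invr_gt0; lra.
have v_gt0 : 0 < v by rewrite invr_gt0; lra.
have u_le : u <= 1 / 100 by rewrite div1r lef_pV2 ?posrE; lra.
have uv : u = v + v * u by rewrite /u /v; field; lra.
have vu : 100 / 101 * u <= v by rewrite uv; nra.
have c0 : 0 <= 1 - 48 * (u / 56) by lra.
have h1 := ler_wpM2r c0 hx.
have h2 : (y + u / 504) * (g * (1 - 48 * (u / 56))) <= y + u / 504.
  by rewrite -[leRHS]mulr1 ler_wpM2l //; lra.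
have h3 : (x + u / 504) * (1 - 48 * (u / 56)) <= y + u / 504.
  by rewrite (le_trans h1) // (le_trans _ h2) // mulrAC mulrC mulrA.
(* The recursion closes since [100 / (101 * 75)], from the drop [u - v], exceeds
   [6 / 7 * (1 / 75 + 1 / 504)], from the growth; both are coefficients of [u ^ 2]. *)
have h4 : 100 / 101 * u * u <= u - v by rewrite {3}uv addrAC subrr add0r ler_wpM2r // ltW.
by rewrite -(ler_pM2r (_ : 0 < 1 - 48 * (u / 56))); nra.
Qed.

Lemma slope_tail (m M : nat) : (100 <= m)%N ->
  slope [seq p <- iota (210 * m) (210 * M) | prime p] <= (75 * m)%:R^-1.
Proof.
elim: M m => [|M IH] m m_ge; first by rewrite muln0 invr_ge0.
rewrite mulnS iotaD filter_cat -mulnSr.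
have {IH}hq : slope [seq p <- iota (210 * m.+1) (210 * M) | prime p] <= (75 * m.+1)%:R^-1.
  by apply: IH; lia.
have m_gt0 : (0 < m)%N by lia.
have szps := @size_primes_block m ltac:(lia).
have hps : all (leq (210 * m)) [seq p <- iota (210 * m) 210 | prime p].
  by apply/allP => p; rewrite mem_filter mem_iota => /and3P[].
move: (filter _ _) (filter _ _) szps hps hq => qs ps szps hps hq.
have hx := slope_cat qs m_gt0 hps.
have m1 : 100 <= m%:R :> R by rewrite (ler_nat _ 100).
have um k : (k * m)%:R^-1 = m%:R^-1 / k%:R :> R by rewrite natrM invfM mulrC.
rewrite um; rewrite !um in hx.
have u_ge0 : 0 <= m%:R^-1 / 56 :> R by rewrite divr_ge0 ?invr_ge0.
apply: block_recursion m1 (slope_ge0 qs) (bernoulli_inv 48 u_ge0) _ _; last first.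
  by rewrite (le_trans hq) // natrM invfM mulrC -natr1.
apply: le_trans hx _; rewrite mulrC (mulrC (_ ^+ _)) ler_wpM2l //.
  by rewrite addr_ge0 ?slope_ge0 // divr_ge0 ?invr_ge0.
have -> : 3 * (m%:R^-1 / 168%:R) = m%:R^-1 / 56 :> R by field; rewrite pnatr_eq0; lia.
by rewrite ler_weXn2l // lerDl.
Qed.

(** * Numerical evaluation *)

(* Quantities are rounded up to multiples of [1 / scale]. *)
Definition scale : N := N.pow 2 40.
Definition Nval (x : N) : R := (N.to_nat x)%:R.
Definition thrN (p : N) : N := ((p + 4) / 5)%num.
Definition widN (p : N) : N := (p - thrN p)%num.

Lemma NvalD x y : Nval (x + y)%num = Nval x + Nval y.
Proof. by rewrite /Nval N2Nat.inj_add -natrD. Qed.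

Lemma NvalM x y : Nval (x * y)%num = Nval x * Nval y.
Proof. by rewrite /Nval N2Nat.inj_mul -natrM. Qed.

Lemma Nval_ge0 x : 0 <= Nval x.
Proof. exact: ler0n. Qed.

Lemma scale_gt0 : 0 < Nval scale.
Proof. by rewrite ltr0n /scale; lia. Qed.

Lemma Nval_div x y : Nval x / Nval y <= Nval (x / y + 1)%num.
Proof.
have [y0|y_gt0] := posnP (N.to_nat y).
  by rewrite {2}/Nval y0 invr0 mulr0 Nval_ge0.
rewrite ler_pdivrMr ?ltr0n // -NvalM ler_nat.
have : (x < (x / y + 1) * y)%num by have := N.mul_succ_div_gt x y; lia.
lia.
Qed.

Lemma thrNE p : N.to_nat (thrN p) = thr (N.to_nat p).
Proof.
rewrite /thrN /thr; have := N.div_mod (p + 4)%num 5; have := N.mod_lt (p + 4)%num 5.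
by move: (N.div _ _) (N.modulo _ _) => q r; lia.
Qed.

Lemma widNE p : N.to_nat (widN p) = wid (N.to_nat p).
Proof. by rewrite /widN /wid N2Nat.inj_sub thrNE. Qed.

Definition slope_step (p r : N) : N :=
  (r + (3 * r / widN p + 1) + (scale / (4 * thrN p * widN p) + 1))%num.

Lemma slope_stepP (p r : N) ps : slope ps * Nval scale <= Nval r ->
  slope (N.to_nat p :: ps) * Nval scale <= Nval (slope_step p r).
Proof.
move=> h /=; rewrite /slope_step !NvalD.
have h1 := Nval_div (3 * r)%num (widN p).
have h2 := Nval_div scale (4 * thrN p * widN p)%num.
rewrite NvalD NvalM in h1; rewrite NvalD in h2.
have e1 : (Nval (widN p))^-1 = wgt (N.to_nat p) by rewrite /Nval widNE.
have e2 : (Nval (4 * thrN p * widN p)%num)^-1 = (4 * thr (N.to_nat p) * wid (N.to_nat p))%:R^-1.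
  by rewrite /Nval !N2Nat.inj_mul thrNE widNE.
rewrite e1 in h1; rewrite e2 in h2.
have w0 := wgt_ge0 (N.to_nat p).
have h3 := ler_wpM2r w0 h.
have e3 : Nval 3 = 3 by [].
rewrite e3 in h1.
move: (Nval scale) (Nval r) (Nval _) (Nval _) (Nval 1) _^-1 h h1 h2 h3 => S r' x y o u.
lra.
Qed.

Fixpoint Nrange (x : N) (n : nat) : seq N :=
  if n is m.+1 then x :: Nrange (N.succ x) m else [::].

Lemma map_Nrange x n : map N.to_nat (Nrange x n) = iota (N.to_nat x) n.
Proof. by elim: n x => //= n IH x; rewrite IH N2Nat.inj_succ. Qed.

(* Primality, exactly, for [1 < n < 149 ^ 2]. *)
Definition sieved (n : N) : bool :=
  all (fun q => N.eqb n q || ~~ N.eqb (N.modulo n q) 0)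
    [:: 2; 3; 5; 7; 11; 13; 17; 19; 23; 29; 31; 37; 41; 43; 47; 53; 59; 61; 67;
        71; 73; 79; 83; 89; 97; 101; 103; 107; 109; 113; 127; 131; 137; 139]%num.

Lemma prime_sieved n : prime (N.to_nat n) -> sieved n.
Proof.
move=> n_pr; rewrite /sieved; set s := [:: _ & _].
have : all (N.ltb 1) s by [].
elim: s => //= q s IH /andP[q_gt1 /IH->]; rewrite andbT.
have [//|nq] := N.eqb_spec n q; apply/negP => /N.eqb_spec n_mod.
have qn : (N.to_nat q %| N.to_nat n)%N.
  apply/dvdnP; exists (N.to_nat (N.div n q)).
  have := N.div_mod n q; move: (N.div n q) => x; lia.
have q_neq1 : N.to_nat q != 1%N by move/N.ltb_spec0: q_gt1; lia.
by case: nq; apply: N2Nat.inj; rewrite (prime_nt_dvdP n_pr q_neq1 qn).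
Qed.

Definition slope_bound (l : seq N) (r : N) : N :=
  foldr (fun p r => if sieved p then slope_step p r else r) r l.

(** A composite number passing the sieve could only enlarge the bound, so [prime_sieved]
    suffices. *)
Lemma slope_boundP (l : seq N) (r : N) ps : slope ps * Nval scale <= Nval r ->
  slope ([seq p <- map N.to_nat l | prime p] ++ ps) * Nval scale
    <= Nval (slope_bound l r).
Proof.
move=> h; elim: l => //= p l IH; case: ifP => [/prime_sieved-> /=|_].
  exact: slope_stepP.
case: ifP => // _; apply: le_trans IH _; rewrite /slope_step !NvalD -addrA.
by rewrite lerDl !addr_ge0 ?Nval_ge0.
Qed.

(* [v] lists bounds for [load ps k], [load ps k.+1], ..., and [z = 2 ^ k]. *)
Fixpoint load_step (p z : N) (v : seq N) : seq N :=
  match v with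
  | a :: ((b :: _) as v') =>
    (((z - thrN p) * scale + (widN p - 1) * a + b) / widN p + 1)%num
      :: load_step p (2 * z) v'
  | _ => [::]
  end.

Fixpoint load_bounded (ps : seq nat) (k : nat) (v : seq N) : Prop :=
  if v is a :: v' then load ps k * Nval scale <= Nval a /\ load_bounded ps k.+1 v'
  else True.

Lemma load_stepP p z v ps k : (0 < wid (N.to_nat p))%N -> N.to_nat z = (2 ^ k)%N ->
  load_bounded ps k v -> load_bounded (N.to_nat p :: ps) k (load_step p z v).
Proof.
move=> w_gt0; elim: v z k => [|a [|b v] IH] // z k zk [ha hbv].
have [hb _] := hbv; split; last first.
  by apply: IH hbv; rewrite N2Nat.inj_mul zk expnS.
apply: le_trans (Nval_div _ _); rewrite !NvalD !NvalM /= -/(load ps).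
have e0 : Nval (z - thrN p)%num = loss (N.to_nat p) (2 ^ k) * Nval (widN p).
  rewrite /Nval N2Nat.inj_sub zk thrNE widNE /loss mulfVK //.
  by rewrite pnatr_eq0 -lt0n.
have e1 : Nval (widN p - 1)%num = Nval (widN p) - 1.
  by rewrite /Nval N2Nat.inj_sub widNE natrB.
have e2 : wgt (N.to_nat p) = (Nval (widN p))^-1 by rewrite /Nval widNE.
have W_gt0 : 0 < Nval (widN p) by rewrite /Nval widNE ltr0n.
have W_ge1 : 1 <= Nval (widN p) by rewrite /Nval widNE ler1n.
rewrite e0 e1 e2 ler_pdivlMr //.
have h1 : (Nval (widN p) - 1) * (load ps k * Nval scale) <= (Nval (widN p) - 1) * Nval a.
  by rewrite ler_wpM2l // subr_ge0.
move: (Nval scale) (Nval (widN p)) W_gt0 h1 ha hb {e0 e1 e2 W_ge1} => S W W_gt0 h1 ha hb.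
have -> : (loss (N.to_nat p) (2 ^ k) + (1 - W^-1) * load ps k + W^-1 * load ps k.+1)
    * S * W = loss (N.to_nat p) (2 ^ k) * W * S
    + (W - 1) * (load ps k * S) + load ps k.+1 * S.
  by field; rewrite gt_eqF.
by rewrite !lerD.
Qed.

Fixpoint geometric (r : N) (n : nat) : seq N :=
  if n is m.+1 then r :: geometric (4 * r)%num m else [::].

Lemma load_bounded_geometric ps r n k : slope ps * 4 ^+ k * Nval scale <= Nval r ->
  load_bounded ps k (geometric r n).
Proof.
elim: n r k => [|n IH] r k h //; split.
  by apply: le_trans h; rewrite ler_wpM2r ?Nval_ge0 // load_le_slope.
apply: IH; rewrite NvalM exprS; have -> : Nval 4 = 4 by [].
by move: (Nval scale) (Nval r) h => S x h; lra.
Qed.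

(** Each [load_step] shortens the list by one, as entry [k] needs entry [k.+1]; hence the initial
    length [(size l).+1]. *)
Definition load_bound (l : seq N) (r : N) : seq N :=
  foldr (fun p v => load_step p 1 v) (geometric r (size l).+1) l.

Lemma load_boundP (l : seq N) r ps : all (fun p => 0 < wid (N.to_nat p))%N l ->
    slope ps * Nval scale <= Nval r ->
  load_bounded (map N.to_nat l ++ ps) 0 (load_bound l r).
Proof.
rewrite /load_bound; move: (size l).+1 => n hl h.
elim: l hl => [_|p l IH /= /andP[hp /IH]]; last exact: load_stepP.
by apply: load_bounded_geometric; rewrite mulr1.
Qed.

Definition small_primes : seq N := map N.of_nat [seq p <- iota 3 297 | prime p].

(** The starting value is [slope_tail] at [m = 100], where [75 * m = 7500]; for [n = 207 * 100] the
    range ends at [210 * 100], where that tail begins. *)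
Definition certified (l : seq N) (n : nat) : bool :=
  if load_bound l (slope_bound (Nrange 300 n) (scale / 7500 + 1)%num) is a :: _
  then N.ltb a scale else false.

Lemma certificate : certified small_primes (207 * 100).
Proof. by vm_compute. Qed.

Lemma small_primes_wid : all (fun p => 0 < wid (N.to_nat p))%N small_primes.
Proof. by vm_compute. Qed.

Lemma map_small_primes : map N.to_nat small_primes = [seq p <- iota 3 297 | prime p].
Proof. by rewrite /small_primes mapK //; exact: Nat2N.id. Qed.

Lemma load_split_lt1 (l : seq N) (n M : nat) ps : map N.to_nat l = ps ->
    all (fun p => 0 < wid (N.to_nat p))%N l ->
    certified l n ->
    (N.to_nat 300 + n = 210 * 100)%N ->
  load (ps ++ [seq p <- iota (N.to_nat 300) (n + 210 * M) | prime p]) 0 < 1.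
Proof.
move=> <- hw cert e; rewrite iotaD e filter_cat -map_Nrange.
have h1 : slope [seq p <- iota (210 * 100) (210 * M) | prime p] * Nval scale
    <= Nval (scale / 7500 + 1)%num.
  apply: le_trans (Nval_div _ _); rewrite mulrC ler_wpM2l ?Nval_ge0 //.
  have -> : Nval 7500 = (75 * 100)%:R by congr (_%:R); lia.
  exact: slope_tail.
have := load_boundP hw (slope_boundP (Nrange 300 n) h1).
move: cert; rewrite /certified; case: (load_bound _ _) => // x v /N.ltb_spec0 xs [hx _].
rewrite -(ltr_pM2r scale_gt0) mul1r; apply: le_lt_trans hx _.
by rewrite /Nval; move: scale xs => S xs; rewrite ltr_nat; lia.
Qed.

Lemma load_lt1 M : load [seq p <- iota 3 (297 + (207 * 100 + 210 * M)) | prime p] 0 < 1.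
Proof.
rewrite iotaD filter_cat.
have := @load_split_lt1 _ (207 * 100) M _ map_small_primes small_primes_wid certificate.
by apply; lia.
Qed.

End Covering.

(** * Deduction of the theorem *)

Lemma dvdn_prod_primes (n : nat) (ps : seq nat) : (0 < n)%N -> squarefree n ->
  (forall p, prime p -> (p %| n)%N -> p \in ps) -> (n %| \prod_(p <- ps) p)%N.
Proof.
move=> n_gt0 sqf hps; apply/dvdn_partP => // p; rewrite mem_primes => /and3P[p_pr _ pn].
have -> : (n`_p = p)%N.
  rewrite p_part; have := sqf p p_pr; rewrite mulnn pfactor_dvdn // -leqNgt.
  have : (0 < logn p n)%N by rewrite logn_gt0 mem_primes p_pr n_gt0.
  by case: (logn p n) => [|[]].
by rewrite (big_rem p) ?hps ?dvdn_mulr.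
Qed.

(* A finite family of progressions a_i + d_i Z, indexed by 'I_k. *)
Theorem theorem1p1 (k : nat) (a : 'I_k -> int) (d : 'I_k -> nat)
  (hd1 : forall i, (1 < d i)%N)
  (hdist : injective d)
  (hsq : forall i, squarefree (d i))
  (hcov : forall x : int, exists i : 'I_k, (x = a i %[mod (d i)%:Z])%Z) :
  exists i : 'I_k, ~~ odd (d i).
Proof.
apply/existsP; apply: contraT; rewrite negb_exists => /forallP hodd.
(* [M] bounds every modulus, hence all prime factors; the list of primes only has to reach beyond
   it. *)
pose M := (\sum_i d i)%N.
have := load_lt1 rat M; set L := (297 + _)%N.
have hL : (M < 3 + L)%N by rewrite /L; lia.
move: L hL => L hL.
set ps := [seq p <- iota 3 L | prime p] => hload.
have ps_pr : all prime ps by apply: filter_all.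
have dps i : (d i %| \prod_(p <- ps) p)%N.
  have d_gt0 : (0 < d i)%N by rewrite ltnW.
  apply: dvdn_prod_primes => // p p_pr pd; rewrite mem_filter p_pr mem_iota /=.
  have p_le : (p <= M)%N.
    by rewrite (leq_trans (dvdn_leq _ pd)) // /M (bigD1 i) //= leq_addr.
  have p_gt2 : (2 < p)%N.
    rewrite odd_prime_gt2 //; have := hodd i; rewrite negbK.
    by apply: dvdn_odd.
  by rewrite p_gt2 (leq_ltn_trans p_le).
have risk1 : risk rat d ps setT < 1.
  by apply: le_lt_trans hload; apply: (@risk_le_load _ _ _ ps [::]).
have [x hx] : exists x, forall i, ~ (x = a i %[mod d i])%Z.
  apply: (@exists_uncovered rat _ a d ps 1 0 setT) => //.
  - by rewrite filter_uniq ?iota_uniq.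
  - by move=> p; rewrite mem_filter mem_iota coprimen1 => /and3P[-> ->].
  - by move=> i; rewrite mul1n.
  - by move=> i; rewrite dvdn1 => /eqP d1; have := hd1 i; rewrite d1.
  - by move=> i x; rewrite inE.
by have [i /hx] := hcov x.
Qed.
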